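(* Let $G$ be a directed graph on $n$ vertices, and let its vertices be ordered according to a permutation $\pi$ chosen uniformly at random. Then the parallel greedy algorithm described in the context (run with respect to the ordering $\pi$) terminates in $O(\log^2 n)$ rounds with probability $1-n^{-\Omega(1)}$.
   Context: The (directed) LFMIS of $G$ with respect to the ordering is the set $I$ produced by processing vertices in increasing order, adding a vertex to $I$ if it is still alive and then marking all its out-neighbors (heads $j$ of edges $(i,j)$) dead. The parallel greedy algorithm: start with $I=\emptyset$; while $G$ is nonempty (one round per iteration): let $J$ be the set of vertices $v$ of the current graph such that there is no remaining edge $(u,v)$ with $u$ earlier than $v$ in the ordering; add $J$ to $I$; remove from $G$ every vertex of $J$ and every vertex $u$ with an edge $(v,u)$ for some $v\in J$.
   Formalization: In each round only those out-neighbours of J that come later in the ordering are removed, not all out-neighbours; with removal of earlier ones too, the algorithm need not compute the LFMIS and the O(log^2 n) bound fails for some directed graphs. *)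

(* Defs.v *)
From mathcomp Require Import all_boot all_order all_algebra all_fingroup.
From mathcomp Require Import reals.

Set Implicit Arguments.
Unset Strict Implicit.
Unset Printing Implicit Defensive.

Local Open Scope nat_scope.

(* A directed graph on n vertices is a relation e on 'I_n, with an edge (u, v)
   when e u v.  Loops are allowed; they never influence the algorithms below.
   A permutation pi orders the vertices: pi v is the position of v. *)
Definition earlier (n : nat) (pi : 'S_n) (u v : 'I_n) : bool := pi u < pi v.

(* Sequential algorithm; the state is (I, set of dead vertices). *)
Definition lfmis_step (n : nat) (e : rel 'I_n) (S : {set 'I_n} * {set 'I_n})
    (v : 'I_n) : {set 'I_n} * {set 'I_n} :=
  if v \in S.2 then S else (v |: S.1, S.2 :|: [set u | e v u]).

Definition lfmis (n : nat) (e : rel 'I_n) (pi : 'S_n) : {set 'I_n} :=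
  (foldl (lfmis_step e) (set0, set0) [seq (pi^-1)%g i | i <- enum 'I_n]).1.

Definition sources (n : nat) (e : rel 'I_n) (pi : 'S_n) (G : {set 'I_n}) :
    {set 'I_n} :=
  [set v in G | [forall u in G, ~~ (e u v && earlier pi u v)]].

(* Only later out-neighbours are removed.  A removal of earlier ones as well
   would not compute the LFMIS: take the edges (0,1), (1,2), (3,2) and the
   order 0, 1, 2, 3.  The LFMIS is {0, 2, 3}, but 3 would enter I in the first
   round and remove 2. *)
Definition removed (n : nat) (e : rel 'I_n) (pi : 'S_n) (J : {set 'I_n}) :
    {set 'I_n} :=
  [set u | [exists v in J, e v u && earlier pi v u]].

(* One round; the state is (I, vertices of the current graph). *)
Definition greedy_round (n : nat) (e : rel 'I_n) (pi : 'S_n)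
    (S : {set 'I_n} * {set 'I_n}) : {set 'I_n} * {set 'I_n} :=
  let J := sources e pi S.2 in
  (S.1 :|: J, S.2 :\: (J :|: removed e pi J)).

Definition greedy_state (n : nat) (e : rel 'I_n) (pi : 'S_n) (k : nat) :
    {set 'I_n} * {set 'I_n} :=
  iter k (greedy_round e pi) (set0, setT).

Lemma greedy_round_card (n : nat) (e : rel 'I_n) (pi : 'S_n)
    (S : {set 'I_n} * {set 'I_n}) :
  S.2 != set0 -> #|(greedy_round e pi S).2| < #|S.2|.
Proof.
case/set0Pn=> v0 v0S; apply: proper_card.
pose v := [arg min_(u < v0 in S.2) (pi u : nat)].
have [vS vmin] : v \in S.2 /\ forall u, u \in S.2 -> pi v <= pi u.
  by rewrite /v; case: arg_minnP.
apply/properP; split; first exact: subsetDl.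
exists v => //; rewrite !inE vS; apply/nandP; left; rewrite negbK.
by apply/orP; left; apply/forall_inP => u /vmin; rewrite /earlier ltnNge => ->; rewrite andbF.
Qed.

Lemma greedy_terminates (n : nat) (e : rel 'I_n) (pi : 'S_n) :
  exists k, (greedy_state e pi k).2 == set0.
Proof.
have H k : (exists j, (greedy_state e pi j).2 == set0)
         \/ #|(greedy_state e pi k).2| + k <= n.
  elim: k => [|k [|IH]]; [|by left|].
    by right; rewrite addn0 /= cardsT card_ord.
  have [Z|NZ] := eqVneq (greedy_state e pi k).2 set0.
    by left; exists k; rewrite Z.
  right; rewrite addnS; apply: leq_trans IH; rewrite -addSn leq_add2r.
  exact: greedy_round_card NZ.
by case: (H n.+1) => //; rewrite addnS ltnNge leq_addl.
Qed.

Definition greedy_rounds (n : nat) (e : rel 'I_n) (pi : 'S_n) : nat :=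
  ex_minn (greedy_terminates e pi).

Definition greedy_set (n : nat) (e : rel 'I_n) (pi : 'S_n) : {set 'I_n} :=
  (greedy_state e pi (greedy_rounds e pi)).1.

Definition lf_spec (n : nat) (e : rel 'I_n) (pi : 'S_n) (I : {set 'I_n}) :=
  forall v, v \in I <-> forall u, earlier pi u v -> e u v -> u \notin I.

Lemma lf_spec_uniq (n : nat) (e : rel 'I_n) (pi : 'S_n) (I1 I2 : {set 'I_n}) :
  lf_spec e pi I1 -> lf_spec e pi I2 -> I1 = I2.
Proof.
move=> H1 H2; apply/setP => v.
have [k] := ubnP (pi v); elim: k v => // k IH v lev.
have E u : earlier pi u v -> (u \in I1) = (u \in I2).
  by move=> uv; apply: IH; apply: leq_trans uv _.
apply/idP/idP.
  by move/(proj1 (H1 v)) => H; apply/(proj2 (H2 v)) => u uv euv; rewrite -E ?H.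
by move/(proj1 (H2 v)) => H; apply/(proj2 (H1 v)) => u uv euv; rewrite E ?H.
Qed.

Lemma greedy_set_spec (n : nat) (e : rel 'I_n) (pi : 'S_n) :
  lf_spec e pi (greedy_set e pi).
Proof.
pose inv (S : {set 'I_n} * {set 'I_n}) :=
  [/\ forall v u, v \in S.1 -> earlier pi u v -> e u v ->
        (u \notin S.2) && (u \notin S.1),
      forall v, v \notin S.2 -> v \notin S.1 ->
        exists u, [/\ earlier pi u v, e u v & u \in S.1]
    & forall v u, v \in S.2 -> earlier pi u v -> e u v -> u \notin S.1].
have inv_k k : inv (greedy_state e pi k).
  elim: k => [|k]; first by split=> v; rewrite ?inE // => u; rewrite inE.
  rewrite /greedy_state iterS -/(greedy_state e pi k).
  case: (greedy_state e pi k) => I G [/= P2 P3 P4]; split=> /=.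
  - move=> v u; rewrite inE => /orP[vI|vJ] uv euv.
      have /andP[uG uI] := P2 v u vI uv euv.
      by rewrite !inE (negbTE uG) (negbTE uI) andbF.
    move: vJ; rewrite inE => /andP[vG /forall_inP vs].
    have uG : u \notin G by apply/negP => /vs; rewrite uv euv.
    by rewrite !inE (negbTE uG) (negbTE (P4 v u vG uv euv)) andbF.
  - move=> v; rewrite 2!inE negb_and negbK => vG; rewrite inE negb_or => /andP[vI vJ].
    have [vG0|vG0] := boolP (v \in G); last first.
      by have [u [uv euv uI]] := P3 v vG0 vI; exists u; rewrite inE uI.
    move: vG; rewrite vG0 orbF (negbTE vJ) /=.
    rewrite inE => /exists_inP[u uJ /andP[euv uv]].
    by exists u; rewrite inE uJ orbT.
  - move=> v u; rewrite 2!inE negb_or => /andP[/andP[vJ vR] vG] uv euv.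
    rewrite inE negb_or (P4 v u vG uv euv) /=; apply: contra vR => uJ.
    by rewrite inE; apply/exists_inP; exists u => //; rewrite euv uv.
rewrite /greedy_set /greedy_rounds; case: ex_minnP => k /eqP Gk _.
have [P2 P3 _] := inv_k k; move=> v; split.
  by move=> vI u uv euv; have /andP[] := P2 v u vI uv euv.
move=> H; have [//|vI] := boolP (v \in _); have [|u [uv euv uI]] := P3 v _ vI.
  by rewrite Gk inE.
by have := H u uv euv; rewrite uI.
Qed.

Lemma lfmis_spec (n : nat) (e : rel 'I_n) (pi : 'S_n) :
  lf_spec e pi (lfmis e pi).
Proof.
pose s := [seq (pi^-1)%g i | i <- enum 'I_n].
pose St k := foldl (lfmis_step e) (set0, set0) (take k s).
have szs : size s = n by rewrite size_map size_enum_ord.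
have inv k : k <= n ->
  [/\ forall v, v \in (St k).1 -> pi v < k,
      forall u, (u \in (St k).2) = [exists v in (St k).1, e v u]
    & forall v, pi v < k -> v \in (St k).1 <->
        forall u, earlier pi u v -> e u v -> u \notin (St k).1].
  elim: k => [_|k IH kn].
    rewrite /St take0 /=; split=> [v|u|//]; rewrite inE //.
    by apply/esym/existsP => -[v]; rewrite inE.
  have [P1 P2 P3] := IH (ltnW kn).
  pose w := (pi^-1)%g (Ordinal kn).
  have pw : pi w = k :> nat by rewrite /w permKV.
  have eqw v : pi v = k :> nat -> v = w.
    by move=> pv; apply: (@perm_inj _ pi); apply: val_inj; rewrite /= pv pw.
  have StS : St k.+1 = lfmis_step e (St k) w.
    rewrite /St (take_nth w) ?szs // -cats1 foldl_cat /=; congr lfmis_step.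
    rewrite (nth_map (Ordinal kn)) ?size_enum_ord //; congr ((pi^-1)%g _).
    by apply: val_inj; rewrite /= nth_enum_ord.
  have wI : w \notin (St k).1 by apply/negP => /P1; rewrite pw ltnn.
  have wD : (w \notin (St k).2) <->
      forall u, earlier pi u w -> e u w -> u \notin (St k).1.
    rewrite P2 negb_exists_in; split.
      by move=> /forall_inP H u _ euw; apply/negP => /H; rewrite euw.
    move=> H; apply/forall_inP => u uI; apply/negP => euw.
    by have := H u _ euw; rewrite uI /earlier pw P1 // => /(_ isT).
  rewrite StS /lfmis_step; case: ifPn => [wDk|wDk] /=.
    split=> [v /P1 /ltnW //|//|v]; rewrite ltnS leq_eqVlt => /orP[/eqP/eqw ->|/P3 //].
    by rewrite (negbTE wI); split=> // /wD; rewrite wDk.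
  split=> [v|u|v].
  - by rewrite 2!inE => /orP[/eqP ->|/P1/ltnW //]; rewrite pw.
  - rewrite 2!inE P2; apply/orP/exists_inP => [[/exists_inP[v vI evu]|ewu]|[v]].
    + by exists v => //; rewrite 2!inE vI orbT.
    + by exists w => //; rewrite 2!inE eqxx.
    + rewrite 2!inE => /orP[/eqP -> ewu|vI evu]; first by right.
      by left; apply/exists_inP; exists v.
  - move=> vk; have -> : (v \in w |: (St k).1) <->
        forall u, earlier pi u v -> e u v -> u \notin (St k).1.
      rewrite 2!inE; move: vk; rewrite ltnS leq_eqVlt => /orP[/eqP/eqw ->|vk].
        by rewrite eqxx; split=> // _; apply/wD.
      have /negbTE -> : v != w by apply: contraTneq vk => ->; rewrite pw ltnn.
      exact: P3.
    have uw u : earlier pi u v -> (u \in (w |: (St k).1)) = (u \in (St k).1).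
      rewrite /earlier 2!inE => uv; case: eqP => // uE; subst u.
      by move: (leq_trans uv vk); rewrite pw ltnn.
    by split=> H u uv euv; have := H u uv euv; rewrite uw.
have -> : lfmis e pi = (St n).1 by rewrite /St take_oversize ?szs.
by have [_ _ P3] := inv n (leqnn n); move=> v; apply: P3.
Qed.

Lemma greedy_set_lfmis (n : nat) (e : rel 'I_n) (pi : 'S_n) :
  greedy_set e pi = lfmis e pi.
Proof. exact: lf_spec_uniq (greedy_set_spec e pi) (lfmis_spec e pi). Qed.

Definition uniform_prob (R : realType) (T : finType) (A : {set T}) : R :=
  (#|A|%:R / #|T|%:R)%R.

(* Main.v *)
Require Import Defs.
From mathcomp Require Import all_boot all_order all_algebra all_fingroup.
From mathcomp Require Import reals exp.
From mathcomp Require Import zify.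

Set Implicit Arguments.
Unset Strict Implicit.
Unset Printing Implicit Defensive.

Local Open Scope nat_scope.

(** Cut the positions into the O(log n) phases [2^k, 2^(k+1)). A vertex that the
  sequential algorithm has left alive before phase k has, with high
  probability, only O(n log n / 2^k) live in-neighbours left: otherwise one of
  them would have come up among the first 2^k positions and killed it. Given
  this degree bound D, the phase occupies m positions out of N remaining ones
  with m D / N = O(log n), so the expected number of live paths of l vertices
  with increasing positions in the phase is at most n (m D / N)^(l-1) / l!,
  which is tiny for l = C log n. A vertex of the phase surviving l rounds would
  be the end of such a path, hence each phase costs O(log n) rounds. The
  conditioning on the first positions is done by transposing later positions,
  and all probabilities are counts of permutations. *)

(** * The live set of the sequential algorithm *)

(* The vertices at positions at least k that the sequential algorithm has not
   killed after the first k positions; v enters the LFMIS iff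
   v \in alive e pi (pi v). *)
Fixpoint alive (n : nat) (e : rel 'I_n) (pi : 'S_n) (k : nat) : {set 'I_n} :=
  if k is j.+1 then
    [set u in alive e pi j | (j < pi u) &&
       [forall v in alive e pi j, (pi v == j :> nat) ==> ~~ e v u]]
  else setT.

Lemma alive_sub (n : nat) (e : rel 'I_n) pi j k :
  j <= k -> alive e pi k \subset alive e pi j.
Proof.
move=> /subnK <-; elim: (k - j) => [|i IH] //; apply: subset_trans IH.
by apply/subsetP => u; rewrite /= inE => /andP[].
Qed.

Lemma alive_geq (n : nat) (e : rel 'I_n) pi k u : u \in alive e pi k -> k <= pi u.
Proof. by case: k => [|k] //=; rewrite inE => /and3P[]. Qed.

Lemma alive_intro (n : nat) (e : rel 'I_n) (pi : 'S_n) k u : k <= pi u ->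
  (forall v, pi v < k -> v \in alive e pi (pi v) -> ~~ e v u) ->
  u \in alive e pi k.
Proof.
elim: k => [|k IH] ku H /=; first by rewrite inE.
rewrite inE IH ?(ltnW ku) //=; last by move=> v vk; apply: H; apply: ltnW.
rewrite ku /=; apply/forall_inP => v vA; apply/implyP => /eqP vk.
by apply: H; rewrite vk.
Qed.

Lemma alive_elim (n : nat) (e : rel 'I_n) (pi : 'S_n) k u v :
  u \in alive e pi k -> pi v < k -> v \in alive e pi (pi v) -> ~~ e v u.
Proof.
move=> uA vk vA; have := subsetP (alive_sub e pi vk) u uA.
by rewrite /= inE => /and3P[_ _ /forall_inP/(_ v vA)]; rewrite eqxx.
Qed.

(** Right multiplication relabels positions, and the run up to time [k] reads only the occupants of
    positions below [k]. *)
Lemma alive_mul (n : nat) (e : rel 'I_n) (pi t : 'S_n) k :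
  (forall i : 'I_n, i < k -> t i = i) -> alive e (pi * t)%g k = alive e pi k.
Proof.
elim: k => [|k IH] // H /=.
have lt_t (i : 'I_n) : (t i < k.+1) = (i < k.+1).
  apply/idP/idP => ik; last by rewrite H.
  by have /perm_inj <- := H _ ik.
rewrite IH; last by move=> i ik; apply: H; apply: ltnW.
apply/setP => u; rewrite !inE permM; congr (_ && _).
rewrite ltnNge -ltnS lt_t ltnS -ltnNge; congr (_ && _).
apply: eq_forallb => v; rewrite permM.
suff -> : (t (pi v) == k :> nat) = (pi v == k :> nat) by [].
case: (ltnP (pi v) k.+1) => vk; first by rewrite H.
have tk := vk; rewrite leqNgt -lt_t -leqNgt in tk.
by rewrite !gtn_eqF.
Qed.

(** * Parallel rounds against the sequential run *)

(** An LFMIS vertex can leave the graph only as a source, and the round in which it does so removes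
    its later out-neighbours. *)
Lemma greedy_killed (n : nat) (e : rel 'I_n) (pi : 'S_n) r v u :
  v \notin (greedy_state e pi r).2 -> v \in alive e pi (pi v) ->
  e v u -> earlier pi v u -> u \notin (greedy_state e pi r).2.
Proof.
elim: r v u => [|r IH] v u; first by rewrite inE.
rewrite /greedy_state iterS -/(greedy_state e pi r).
set G := (greedy_state e pi r).2 in IH *; rewrite /= -/G.
have [vG|vG] := boolP (v \in G); last first.
  by move=> _ vA euv uv; rewrite inE negb_and (IH v u) ?orbT.
rewrite inE vG andbT negbK inE => /orP[vJ|vR] vA evu uv.
  rewrite !inE negb_and negbK; apply/orP; left; apply/orP; right.
  by apply/existsP; exists v; rewrite vJ evu uv.
have : False; last by [].
move: vR; rewrite inE => /exists_inP[w wJ /andP[ewv wv]].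
(* The source [w] is in the LFMIS: an earlier member pointing to it would either still be present,
   or be gone and by induction have taken [w] along. So [w] would have killed [v]. *)
have wA : w \in alive e pi (pi w).
  apply: alive_intro => // x xw xA; apply/negP => exw.
  move: wJ; rewrite inE => /andP[wG /forall_inP wJ].
  have [xG|xG] := boolP (x \in G); first by have := wJ x xG; rewrite /earlier exw xw.
  by have := IH x w xG xA exw xw; rewrite wG.
by have := alive_elim vA wv wA; rewrite ewv.
Qed.

Lemma greedy_state_alive (n : nat) (e : rel 'I_n) (pi : 'S_n) r a :
  (forall v, v \in (greedy_state e pi r).2 -> a <= pi v) ->
  (greedy_state e pi r).2 \subset alive e pi a.
Proof.
move=> H; apply/subsetP => u uG; apply: alive_intro; first exact: H.
have au := H _ uG; move=> v va vA; apply: contraL uG => evu.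
have vG : v \notin (greedy_state e pi r).2.
  by apply: contraL va => /H; rewrite -leqNgt.
apply: greedy_killed vG vA evu _.
exact: leq_trans va au.
Qed.

Lemma greedy_state_mono (n : nat) (e : rel 'I_n) (pi : 'S_n) i j :
  i <= j -> (greedy_state e pi j).2 \subset (greedy_state e pi i).2.
Proof.
move=> /subnK <-; elim: (j - i) => [|k IH] //; apply: subset_trans IH.
by rewrite addSn /greedy_state iterS; apply: subsetDl.
Qed.

(** A vertex surviving a round was not a source, so an earlier in-neighbour was present before that
    round; going back [j] rounds yields [j] edges. *)
Lemma greedy_survivor_path (n : nat) (e : rel 'I_n) (pi : 'S_n) r a j v :
  (forall v, v \in (greedy_state e pi r).2 -> a <= pi v) ->
  v \in (greedy_state e pi (r + j)).2 ->
  exists x s, [/\ size s = j, last x s = v,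
    path (fun u w => e u w && earlier pi u w) x s
    & all (fun u => (u \in alive e pi a) && (pi u <= pi v)) (x :: s)].
Proof.
move=> Ha; have HA := subsetP (greedy_state_alive Ha).
elim: j v => [|j IH] v vG.
  by exists v, [::]; split=> //=; rewrite leqnn andbT HA //; rewrite addn0 in vG.
have vA : v \in alive e pi a.
  by apply: HA; apply: subsetP vG; apply: greedy_state_mono; apply: leq_addr.
move: vG; rewrite addnS /greedy_state iterS -/(greedy_state e pi _) /=.
rewrite !inE negb_or => /andP[/andP[+ _] vG]; rewrite vG /=.
rewrite negb_forall_in => /exists_inP[u uG]; rewrite negbK => /andP[euv uv].
have [x [s [ss su ps As]]] := IH u uG.
exists x, (rcons s v); split.
- by rewrite size_rcons ss.
- by rewrite last_rcons.
- by rewrite rcons_path ps su /= euv uv.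
- have {}As : all (fun u => (u \in alive e pi a) && (pi u <= pi v)) (x :: s).
    apply: sub_all As => w /andP[-> wu] /=; apply: ltnW.
    exact: leq_ltn_trans wu uv.
  by move: As; rewrite /= all_rcons vA leqnn.
Qed.

(** * Conditioning by transpositions, and the decay of live in-degrees *)

(* If X and W do not depend on which vertices occupy which positions of Q,
   the vertex at position p of Q is uniform among those occupying Q. *)
Lemma card_exchange (n : nat) (X : {set 'S_n}) (W : 'S_n -> {set 'I_n})
    (p : 'I_n) (Q : {set 'I_n}) :
  (forall q pi, q \in Q -> ((pi * tperm p q)%g \in X) = (pi \in X)) ->
  (forall q pi, q \in Q -> W (pi * tperm p q)%g = W pi) ->
  #|Q| * #|[set pi in X | (pi^-1)%g p \in W pi]|
  = \sum_(pi in X) #|[set q in Q | (pi^-1)%g q \in W pi]|.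
Proof.
move=> HX HW.
transitivity (\sum_(pi in X) \sum_(q in Q) ((pi^-1)%g q \in W pi : nat)); last first.
  apply: eq_bigr => pi _; rewrite -sum1_card big_mkcond [RHS]big_mkcond /=.
  by apply: eq_bigr => q _; rewrite inE; case: (q \in Q); case: (_ \in W pi).
rewrite exchange_big /= -sum_nat_const; apply: eq_bigr => q qQ.
(* Swapping positions [p] and [q] moves the occupant of [p] to [q] and changes neither [X] nor
   [W]. *)
rewrite [RHS](reindex_inj (mulIg (tperm p q))) /= -sum1_card big_mkcond.
rewrite [RHS]big_mkcond /=; apply: eq_bigr => pi _; rewrite inE HX // HW //.
rewrite invMg tpermV permM tpermR.
by case: (pi \in X); case: (_ \in W pi).
Qed.

Definition preds (n : nat) (e : rel 'I_n) pi k v : {set 'I_n} :=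
  [set u in alive e pi k | e u v].

(* The event decreases with k, and the vertex at position k kills v, or is v,
   with conditional probability at least d / n. *)
Definition crowded (n : nat) (e : rel 'I_n) k d v : {set 'S_n} :=
  [set pi | (v \in alive e pi k) && (d <= #|preds e pi k v|)].

Lemma alive_tperm (n : nat) (e : rel 'I_n) (pi : 'S_n) k (p q : 'I_n) :
  k <= p -> k <= q -> alive e (pi * tperm p q)%g k = alive e pi k.
Proof.
move=> kp kq; apply: alive_mul => i ik; apply: tpermD.
  by apply: contraL ik => /eqP <-; rewrite -leqNgt.
by apply: contraL ik => /eqP <-; rewrite -leqNgt.
Qed.

Lemma crowded_step (n : nat) (e : rel 'I_n) k d v : k < n ->
  n * #|crowded e k.+1 d v| <= (n - d) * #|crowded e k d v|.
Proof.
move=> kn; pose p := Ordinal kn; pose Q := [set q : 'I_n | k <= q].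
pose hit := [set pi in crowded e k d v | (pi^-1)%g p \in preds e pi k v].
have cH : #|Q| * #|hit| = \sum_(pi in crowded e k d v) #|preds e pi k v|.
  rewrite /hit card_exchange.
  - apply: eq_bigr => pi _; rewrite -[RHS](card_imset _ (@perm_inj _ pi)).
    apply: eq_card => q; rewrite !inE; apply/andP/imsetP => [[_ H]|[u]].
      by exists ((pi^-1)%g q); rewrite ?permKV ?inE.
    rewrite !inE => /andP[uA euv] ->; rewrite permK uA euv; split=> //.
    exact: alive_geq uA.
  - by move=> q pi; rewrite !inE => kq; rewrite /preds alive_tperm.
  - by move=> q pi; rewrite inE => kq; rewrite /preds alive_tperm.
(* [Q] is bounded by all [n] positions, so that every step yields the same factor. *)
have hd : d * #|crowded e k d v| <= n * #|hit|.
  rewrite mulnC -sum_nat_const; apply: (@leq_trans (#|Q| * #|hit|)).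
    by rewrite cH; apply: leq_sum => pi; rewrite inE => /andP[].
  rewrite leq_mul2r; apply/orP; right; apply: leq_trans (max_card _) _.
  by rewrite card_ord.
(* On [hit] the live occupant of position [k] has an edge to [v], so [v] is not alive at time
   [k.+1]. *)
have sub : crowded e k.+1 d v \subset crowded e k d v :\: hit.
  have ksub pi := subsetP (alive_sub e pi (leqnSn k)).
  apply/subsetP => pi; rewrite inE => /andP[vA dv].
  have piC : pi \in crowded e k d v.
    rewrite inE ksub //=; apply: leq_trans dv _; apply: subset_leq_card.
    by apply/subsetP => u; rewrite ![_ \in preds _ _ _ _]in_set => /andP[/(ksub pi) -> ->].
  rewrite in_setD piC andbT in_set piC /= in_set; apply/negP => /andP[wA ewv].
  move: vA; rewrite /= inE => /and3P[_ _ /forall_inP/(_ _ wA)].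
  by rewrite permKV eqxx ewv.
have hs : hit \subset crowded e k d v by apply/subsetP => pi; rewrite inE => /andP[].
move: (subset_leq_card sub); rewrite cardsD (setIidPr hs) => le.
apply: (@leq_trans (n * (#|crowded e k d v| - #|hit|))).
  by rewrite leq_mul2l le orbT.
by rewrite mulnBr mulnBl leq_sub2l.
Qed.

Lemma card_crowded (n : nat) (e : rel 'I_n) k d v : k <= n ->
  n ^ k * #|crowded e k d v| <= (n - d) ^ k * n`!.
Proof.
elim: k => [|k IH] kn.
  rewrite !expn0 !mul1n; apply: leq_trans (max_card _) _.
  by rewrite card_Sn.
rewrite expnSr -mulnA; apply: (@leq_trans (n ^ k * ((n - d) * #|crowded e k d v|))).
  by rewrite leq_mul2l crowded_step ?orbT.
by rewrite mulnCA expnS -mulnA leq_mul2l IH ?orbT // ltnW.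
Qed.

(** * Chains of live vertices in a window of positions *)

Definition sparse (n : nat) (e : rel 'I_n) k d : {set 'S_n} :=
  [set pi | [forall v in alive e pi k, #|preds e pi k v| <= d]].

(** Indexed by positions rather than vertices: for a fixed list of positions the occupants are
    random and can be exchanged. *)
Definition chain (n : nat) (e : rel 'I_n) (pi : 'S_n) a (ps : seq 'I_n) : bool :=
  let vs := [seq (pi^-1)%g p | p <- ps] in
  sorted e vs && all [in alive e pi a] vs.

Lemma chain_cons (n : nat) (e : rel 'I_n) pi a p q ps :
  chain e pi a [:: p, q & ps]
  = chain e pi a (q :: ps) && ((pi^-1)%g p \in preds e pi a ((pi^-1)%g q)).
Proof.
rewrite /chain /preds /= !inE.
by case: (e _ _); case: path; case: (_ \in _); case: (_ \in _); case: all.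
Qed.

Lemma chain_tperm (n : nat) (e : rel 'I_n) (pi : 'S_n) a (p q : 'I_n) ps :
  a <= p -> a <= q -> p \notin ps -> q \notin ps ->
  chain e (pi * tperm p q)%g a ps = chain e pi a ps.
Proof.
move=> ap aq pp qp; rewrite /chain alive_tperm //.
rewrite (_ : [seq ((pi * tperm p q)^-1)%g x | x <- ps] = [seq (pi^-1)%g x | x <- ps]) //.
apply/eq_in_map => x xp; rewrite invMg permM tpermV tpermD //.
  by apply: contraNneq pp => ->.
by apply: contraNneq qp => ->.
Qed.

Lemma card_ord_window (n b c : nat) : #|[set i : 'I_n | b <= i < c]| <= c - b.
Proof.
rewrite cardE -(size_map val) -[leqRHS](size_iota b); apply: uniq_leq_size.
  by rewrite map_inj_uniq ?enum_uniq //; apply: val_inj.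
move=> _ /mapP[i + ->]; rewrite mem_enum inE mem_iota => /andP[bi ic] /=.
by rewrite bi /= subnKC // (leq_trans bi (ltnW ic)).
Qed.

(** The chain is revealed from its last position backwards: each new occupant is uniform over the
    later positions not yet used, and at most [d] choices are live predecessors of the next vertex.
    The last position is unconstrained, whence the lone factor [n - a]. *)
Lemma card_chain (n : nat) (e : rel 'I_n) a d p ps :
  uniq (p :: ps) -> all (fun i : 'I_n => a <= i) (p :: ps) ->
  (n - a) ^_ (size ps).+1 * #|[set pi in sparse e a d | chain e pi a (p :: ps)]|
  <= (n - a) * d ^ size ps * n`!.
Proof.
elim: ps p => [|q ps IH] p.
  move=> _ _; rewrite ffactn1 /= expn0 muln1 leq_mul2l.
  apply/orP; right; apply: leq_trans (max_card _) _.
  by rewrite card_Sn.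
move=> /= /andP[pq uq] /andP[ap aq].
set X := [set pi in sparse e a d | chain e pi a (q :: ps)].
set Y := [set pi in _ | _].
pose Q := [set i : 'I_n | (a <= i) && (i \notin q :: ps)].
pose W pi := preds e pi a ((pi^-1)%g q).
have YE : Y = [set pi in X | (pi^-1)%g p \in W pi].
  by apply/setP => pi; rewrite [LHS]in_set chain_cons andbA [RHS]in_set [pi \in X]in_set.
have cY : #|Q| * #|Y| = \sum_(pi in X) #|[set i in Q | (pi^-1)%g i \in W pi]|.
  rewrite YE card_exchange // => i pi; rewrite inE => /andP[ai iq].
    by rewrite ![in LHS]inE ![in RHS]inE chain_tperm // /preds alive_tperm.
  rewrite /W /preds alive_tperm // invMg permM tpermV tpermD //.
    by apply: contraNneq pq => ->; rewrite inE eqxx.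
  by apply: contraNneq iq => ->; rewrite inE eqxx.
have le : #|Q| * #|Y| <= d * #|X|.
  rewrite cY mulnC -sum_nat_const; apply: leq_sum => pi; rewrite inE => /andP[sp ch].
  move: sp; rewrite inE => /forall_inP/(_ ((pi^-1)%g q)) H.
  apply: leq_trans (H _); last by move: ch; rewrite /chain /= => /and3P[].
  rewrite -[leqLHS](card_imset _ (@perm_inj _ (pi^-1)%g)); apply: subset_leq_card.
  by apply/subsetP => u /imsetP[i + ->]; rewrite in_set => /andP[].
have cQ : n - a - (size ps).+1 <= #|Q|.
  have -> : Q = [set i : 'I_n | a <= i] :\: [set i in q :: ps].
    by apply/setP => i; rewrite !inE andbC.
  rewrite cardsD; apply: leq_sub.
    have : #|[set i : 'I_n | a <= i]| + #|[set i : 'I_n | i < a]| = n.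
      rewrite -[RHS](card_ord n) -(cardsC [set i : 'I_n | a <= i]); congr (_ + _).
      by apply: eq_card => i; rewrite !inE ltnNge.
    suff : #|[set i : 'I_n | i < a]| <= a by lia.
    by have := card_ord_window n 0 a; rewrite subn0.
  apply: (@leq_trans #|[set i in q :: ps]|); first by apply: subset_leq_card; apply: subsetIr.
  by rewrite cardsE; apply: card_size.
rewrite ffactnSr -mulnA expnS.
apply: (@leq_trans ((n - a) ^_ (size ps).+1 * (d * #|X|))).
  by rewrite leq_mul2l; apply/orP; right; apply: leq_trans le; rewrite leq_mul2r cQ orbT.
rewrite mulnCA [(n - a) * (d * _)]mulnCA -[d * _ * _]mulnA leq_mul2l.
by rewrite (IH q) ?orbT.
Qed.

Lemma enum_sorted_set (n : nat) (ps : seq 'I_n) :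
  sorted (relpre val ltn) ps -> enum [set p in ps] = ps.
Proof.
move=> sps; apply: (@irr_sorted_eq _ (relpre val ltn)) => //.
- by move=> x y z; apply: ltn_trans.
- by move=> x; apply: ltnn.
- rewrite {1}/enum_mem sorted_filter //; first by move=> x y z; apply: ltn_trans.
  by rewrite -enumT -sorted_map val_enum_ord iota_ltn_sorted.
- by move=> x; rewrite mem_enum inE.
Qed.

(** A set of positions, listed increasingly by [enum], makes the union bound a binomial coefficient,
    which supplies the factorial in the denominator. *)
Definition long_chain (n : nat) (e : rel 'I_n) a b d l : {set 'S_n} :=
  [set pi in sparse e a d | [exists P : {set 'I_n},
     [&& P \subset [set p : 'I_n | a <= p < b], #|P| == l
       & chain e pi a (enum P)]]].

Lemma path_long_chain (n : nat) (e : rel 'I_n) (pi : 'S_n) a b d x s :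
  pi \in sparse e a d ->
  path (fun u w => e u w && earlier pi u w) x s ->
  all (fun u => (u \in alive e pi a) && (pi u < b)) (x :: s) ->
  pi \in long_chain e a b d (size s).+1.
Proof.
move=> sp ps /allP As; rewrite in_set sp /=.
pose ws := map pi (x :: s).
have sws : sorted (relpre val ltn) ws.
  rewrite sorted_map; apply: sub_path ps => u w /= /andP[_].
  by rewrite /earlier.
apply/existsP; exists [set p in ws]; apply/and3P; split.
- apply/subsetP => p; rewrite !inE => /(mapP (s := x :: s))[u /As/andP[uA ub] ->].
  by rewrite (alive_geq uA).
- by rewrite cardE enum_sorted_set // size_map.
- rewrite enum_sorted_set // /chain -map_comp (@eq_map _ _ _ id); last first.
    by move=> u /=; rewrite permK.
  rewrite map_id; apply/andP; split; last by apply/allP => u /As /andP[].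
  by apply: sub_path ps => u w /andP[].
Qed.

Lemma leq_card_bigcup (I : Type) (T : finType) (r : seq I) (P : pred I)
    (F : I -> {set T}) :
  #|\bigcup_(i <- r | P i) F i| <= \sum_(i <- r | P i) #|F i|.
Proof.
elim/big_rec2: _ => [|i y z _ le]; first by rewrite cards0.
by apply: leq_trans (leq_card_setU _ _) _; rewrite leq_add2l.
Qed.

Lemma card_long_chain_sum (n : nat) (e : rel 'I_n) a b d l :
  #|long_chain e a b d l.+1| * (n - a) ^_ l.+1
  <= 'C(#|[set p : 'I_n | a <= p < b]|, l.+1) * ((n - a) * d ^ l * n`!).
Proof.
set B := [set p : 'I_n | _].
rewrite -cards_draws -[leqRHS]sum_nat_const.
set F := [set P | _ & _].
pose S (P : {set 'I_n}) := [set pi in sparse e a d | chain e pi a (enum P)].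
have -> : long_chain e a b d l.+1 = \bigcup_(P in F) S P.
  apply/setP => pi; rewrite in_set; apply/andP/bigcupP => [[sp]|[P PF piS]].
    case/existsP=> P /and3P[PB cP ch]; exists P; first by rewrite in_set PB.
    by rewrite in_set sp.
  move: PF piS; rewrite !in_set => /andP[PB cP] /andP[sp ch]; split=> //.
  by apply/existsP; exists P; rewrite PB cP.
have le : #|\bigcup_(P in F) S P| <= \sum_(P in F) #|S P|.
  exact: leq_card_bigcup.
apply: (@leq_trans ((\sum_(P in F) #|S P|) * (n - a) ^_ l.+1)).
  by rewrite leq_mul2r le orbT.
rewrite big_distrl /=; apply: leq_sum => P; rewrite in_set => /andP[PB /eqP cP].
rewrite mulnC.
have : size (enum P) = l.+1 by rewrite -cardE.
have : all (fun i : 'I_n => a <= i) (enum P).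
  apply/allP => p; rewrite mem_enum => /(subsetP PB).
  by rewrite in_set => /andP[].
have := enum_uniq P; rewrite /S.
by case: (enum P) => // p ps u ge [<-]; apply: card_chain.
Qed.

(** Factor by factor, [(m - i) / (N - i) <= m / N]. *)
Lemma ffact_le_expn (m N l : nat) : m <= N -> m ^_ l * N ^ l <= m ^ l * N ^_ l.
Proof.
move=> mN; elim: l => [|l IH] //; rewrite !ffactnSr !expnSr mulnACA.
rewrite [leqRHS]mulnACA; apply: leq_mul => //; rewrite mulnBl mulnBr.
by apply: leq_sub2l; rewrite mulnC leq_mul2l mN orbT.
Qed.

(** For a window of [m] positions and [N = n - a], the union bound
    ['C(m, l.+1) * N * d ^ l / N ^_ l.+1] is at most [m * (m * d / N) ^ l] over (l + 1)!, with
    [m * d / N <= k]. *)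
Lemma card_long_chain (n : nat) (e : rel 'I_n) a b d l k :
  a < n -> b - a <= n - a -> (b - a) * d <= k * (n - a) ->
  #|long_chain e a b d l.+1| * l.+1`! <= (b - a) * k ^ l * n`!.
Proof.
move=> an bn bd; set m := #|[set p : 'I_n | a <= p < b]|.
have mb : m <= b - a := card_ord_window n a b.
set N := n - a in bn bd *; have N0 : 0 < N by rewrite subn_gt0.
have mN := leq_trans mb bn.
(* If [N < l.+1] the falling factorial vanishes and cannot be cancelled, but then the window has no
   room for such a chain. *)
have [lN|Nl] := leqP l.+1 N; last first.
  suff -> : long_chain e a b d l.+1 = set0 by rewrite cards0.
  apply/setP => pi; rewrite in_set in_set0; apply/andP => -[_ /existsP[P]].
  case/and3P=> /subset_leq_card PB /eqP cP _.
  by move: (leq_trans PB mN); rewrite cP leqNgt Nl.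
have H := card_long_chain_sum e a b d l; rewrite -/N -/m in H.
have FN0 : 0 < N ^_ l.+1 * N ^ l.+1 by rewrite muln_gt0 ffact_gt0 lN expn_gt0 N0.
rewrite -(leq_pmul2r FN0); set F := N ^_ l.+1 in H FN0 *.
have le1 : #|long_chain e a b d l.+1| * l.+1`! * (F * N ^ l.+1)
    <= m ^_ l.+1 * N ^ l.+1 * (N * d ^ l * n`!).
  have -> : m ^_ l.+1 * N ^ l.+1 * (N * d ^ l * n`!)
      = 'C(m, l.+1) * (N * d ^ l * n`!) * (l.+1`! * N ^ l.+1).
    by rewrite -bin_ffact -['C(_, _) * _ * _]mulnA mulnAC.
  by rewrite mulnACA leq_mul2r H orbT.
apply: leq_trans le1 _.
apply: (@leq_trans (((b - a) ^ l.+1 * F) * (N * d ^ l * n`!))).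
  rewrite leq_mul2r; apply/orP; right; apply: leq_trans (ffact_le_expn _ mN) _.
  by rewrite leq_mul2r leq_exp2r ?mb ?orbT.
have le2 : ((b - a) * d) ^ l <= (k * N) ^ l.
  by case: (l) => // l'; rewrite leq_exp2r.
rewrite !expnMn in le2; rewrite !expnS.
have -> : (b - a) * (b - a) ^ l * F * (N * d ^ l * n`!)
    = (b - a) * F * N * n`! * ((b - a) ^ l * d ^ l) by lia.
have -> : (b - a) * k ^ l * n`! * (F * (N * N ^ l))
    = (b - a) * F * N * n`! * (k ^ l * N ^ l) by lia.
by rewrite leq_mul2l le2 orbT.
Qed.

(** * Elementary estimates in place of Stirling and the exponential *)

(** All factors of [(l + l) ^_ l] are at least [l], and it is l! times the central binomial
    coefficient, a term of [(1 + 1) ^ (l + l)]. *)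
Lemma expn_le_4fact l : l ^ l <= 4 ^ l * l`!.
Proof.
have : l ^ l <= (l + l) ^_ l.
  rewrite ffact_prod (_ : l ^ l = \prod_(i < l) l); last first.
    by rewrite prod_nat_const card_ord.
  by apply: leq_prod => i _; have := ltn_ord i; lia.
move/leq_trans; apply; rewrite -bin_ffact leq_mul2r; apply/orP; right.
rewrite (_ : 4 ^ l = (1 + 1) ^ (l + l)); last by rewrite -[4]/(2 ^ 2) -expnM mul2n (addnn l).
rewrite expnDn.
under eq_bigr => i _ do rewrite !exp1n !muln1.
have ll : l < (l + l).+1 by lia.
by rewrite (bigD1 (Ordinal ll)) //= leq_addr.
Qed.

(** Bernoulli's inequality [(1 + 1/y)^n >= 1 + n/y], cleared of denominators. *)
Lemma bernoulli_expn y n : y ^ n * (y + n) <= y * y.+1 ^ n.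
Proof.
elim: n => [|n IH]; first by rewrite !expn0 mul1n muln1 addn0.
rewrite !expnS; apply: (@leq_trans (y.+1 * (y ^ n * (y + n)))); last first.
  by rewrite [leqRHS]mulnCA leq_mul2l IH orbT.
by rewrite [y * _]mulnC -mulnA [leqRHS]mulnCA leq_mul2l; apply/orP; right; nia.
Qed.

(** With [n - x] kept fixed, each unit added to [x] gains a factor 2 by Bernoulli, which gives
    [(1 - x/n)^n <= 2^(-x)]. *)
Lemma exp2_mul_expn_sub n x : x <= n -> 2 ^ x * (n - x) ^ n <= n ^ n.
Proof.
have step y : 0 < y -> 2 * y ^ y.+1 <= y.+1 ^ y.+1.
  move=> y0; have := bernoulli_expn y y.+1.
  move=> H; rewrite -(leq_pmul2l y0); apply: leq_trans H.
  by rewrite mulnA mulnC leq_mul2l; apply/orP; right; lia.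
move=> xn; rewrite -{2 3 4}(subnK xn); move: (n - x) => y {xn}; rewrite addnC.
elim: x => [|x IH]; first by rewrite mul1n.
case: y IH => [|y] IH; first by rewrite exp0n ?muln0 ?addSn.
rewrite addSn; apply: leq_trans (step (x + y.+1) _); last by rewrite addnS.
rewrite !expnS -mulnA leq_mul2l /= mulnCA; apply: leq_mul IH.
exact: leq_addl.
Qed.

Lemma exp2_mul_expn_sub_le n x a t : 0 < n -> t * n <= x * a ->
  2 ^ t * (n - x) ^ a <= n ^ a.
Proof.
move=> n0 tx; have [xn|/ltnW/eqP ->] := leqP x n; last first.
  case: a tx => [|a] tx; last by rewrite exp0n ?muln0.
  by case: t tx => // t; rewrite muln0 mulSn; lia.
(* Taking [n]-th powers makes the exponent [x * a / n] integral. *)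
rewrite -(leq_exp2r _ _ n0) expnMn -expnM.
apply: (@leq_trans (2 ^ (x * a) * ((n - x) ^ a) ^ n)).
  by rewrite leq_mul2r leq_exp2l ?tx ?orbT.
rewrite -!expnM [a * n]mulnC !expnM -expnMn.
case: (a) => // a'; rewrite leq_exp2r //; exact: exp2_mul_expn_sub.
Qed.

(** * Failure probability of one phase *)

(* With at least d = degree_bound + 1 predecessors at time a = 2^k, v survives
   with probability at most (1 - d/n)^a <= 2^(-5L) <= n^(-5). *)
Definition degree_bound n L k := 5 * L * n %/ 2 ^ k.

(* The k-th phase covers the positions 2^k, ..., 2^(k+1) - 1. *)
Definition bad_phase (n : nat) (e : rel 'I_n) L k : {set 'S_n} :=
  ~: sparse e (2 ^ k) (degree_bound n L k)
  :|: long_chain e (2 ^ k) (minn (2 ^ k.+1) n) (degree_bound n L k) (80 * L).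

Lemma card_not_sparse (n : nat) (e : rel 'I_n) L k : 2 ^ k < n -> n <= 2 ^ L ->
  #|~: sparse e (2 ^ k) (degree_bound n L k)| * n ^ 4 <= n`!.
Proof.
set a := 2 ^ k; set d := degree_bound n L k => an nL.
have n0 : 0 < n by apply: leq_ltn_trans an.
have a0 : 0 < a by rewrite expn_gt0.
have cr v : #|crowded e a d.+1 v| * n ^ 5 <= n`!.
  have na0 : 0 < n ^ a by rewrite expn_gt0 n0.
  rewrite -(leq_pmul2l na0) mulnA.
  apply: (@leq_trans ((n - d.+1) ^ a * n`! * n ^ 5)).
    by rewrite leq_mul2r card_crowded ?orbT // ltnW.
  rewrite mulnAC leq_mul2r; apply/orP; right.
  apply: (@leq_trans (2 ^ (5 * L) * (n - d.+1) ^ a)).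
    by rewrite mulnC leq_mul2r [5 * L]mulnC expnM leq_exp2r // nL orbT.
  (* The successor undoes the rounding in [d]: [5 * L * n < d.+1 * a]. *)
  apply: exp2_mul_expn_sub_le => //; apply: ltnW.
  by rewrite /d /degree_bound -/a mulnC; have := ltn_ceil (5 * L * n) a0; lia.
have le : #|~: sparse e a d| <= \sum_(v : 'I_n) #|crowded e a d.+1 v|.
  apply: (@leq_trans #|\bigcup_(v : 'I_n) crowded e a d.+1 v|).
    apply: subset_leq_card; apply/subsetP => pi; rewrite !inE.
    rewrite negb_forall_in => /exists_inP[v vA]; rewrite -ltnNge => dv.
    by apply/bigcupP; exists v; rewrite // inE vA.
  exact: leq_card_bigcup.
rewrite -(leq_pmul2l n0) mulnCA -expnS.
apply: (@leq_trans (\sum_(v : 'I_n) n`!)).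
  apply: (@leq_trans ((\sum_(v : 'I_n) #|crowded e a d.+1 v|) * n ^ 5)).
    by rewrite leq_mul2r le orbT.
  by rewrite big_distrl; apply: leq_sum.
by rewrite sum_nat_const card_ord.
Qed.

(** The length comes from [80 = 2 * 4 * 10]: the ratio per step is at most [10 * L], [expn_le_4fact]
    costs a factor 4 per step, and the remaining 2 yields the bound [n * 2^(-80 L)]. *)
Lemma card_phase_long_chain (n : nat) (e : rel 'I_n) L k :
  0 < L -> 2 ^ k < n -> n <= 2 ^ L ->
  #|long_chain e (2 ^ k) (minn (2 ^ k.+1) n) (degree_bound n L k) (80 * L)|
    * n ^ 4 <= n`!.
Proof.
move=> L0; rewrite /degree_bound expnS.
have a0 : 0 < 2 ^ k by rewrite expn_gt0.
move: (2 ^ k) a0 => a a0 an nL; set d := _ %/ a; set b := minn _ _.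
have n0 : 0 < n by apply: leq_ltn_trans an.
have da : d * a <= 5 * L * n := leq_trunc_div _ _.
(* If [2 * a <= n], then [n - a] is at least [n / 2]; otherwise the window is all that remains and
   [d <= 10 * L]. *)
have bd : (b - a) * d <= (10 * L) * (n - a).
  have [a2|a2] := leqP (2 * a) n.
    have -> : b - a = a by rewrite /b; lia.
    apply: (@leq_trans (5 * L * n)); first by rewrite mulnC.
    have : n <= 2 * (n - a) by lia.
    by move/(leq_mul (leqnn (5 * L))) => /leq_trans; apply; lia.
  have -> : b - a = n - a by rewrite /b; lia.
  rewrite mulnC leq_mul2r; apply/orP; right; rewrite -(leq_pmul2r a0).
  by apply: leq_trans da _; have := leq_mul (leqnn (5 * L)) (ltnW a2); lia.
have bn : b - a <= n - a by rewrite /b; lia.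
have [l El] : {l | 80 * L = l.+1} by exists (80 * L).-1; lia.
set LC := long_chain _ _ _ _ _.
have := card_long_chain e l an bn bd; rewrite -El -/LC => H.
have {}H : #|LC| * (80 * L)`! <= n * (10 * L) ^ (80 * L) * n`!.
  apply: leq_trans H _; rewrite leq_mul2r leq_mul ?orbT //; first by lia.
  by rewrite leq_pexp2l; lia.
have {}H : #|LC| * 2 ^ (80 * L) <= n * n`!.
  have p0 : 0 < (40 * L) ^ (80 * L) by rewrite expn_gt0; apply/orP; left; lia.
  rewrite -(leq_pmul2r p0) -mulnA -expnMn (_ : 2 * (40 * L) = 80 * L); last by lia.
  apply: (@leq_trans (#|LC| * (4 ^ (80 * L) * (80 * L)`!))).
    by rewrite leq_mul2l expn_le_4fact orbT.
  rewrite (_ : 40 * L = 4 * (10 * L)) ?(expnMn 4); last by lia.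
  move: H; move: (4 ^ _) ((10 * _) ^ _) => x y H.
  by rewrite mulnCA; have := leq_mul (leqnn x) H; lia.
rewrite -(leq_pmul2l n0) mulnCA -expnS; apply: leq_trans H.
rewrite leq_mul2l; apply/orP; right.
apply: (@leq_trans (2 ^ (L * 5))); first by rewrite expnM leq_exp2r.
by rewrite leq_exp2l; lia.
Qed.

Lemma card_bad_phase (n : nat) (e : rel 'I_n) L k :
  0 < L -> 2 ^ k < n -> n <= 2 ^ L -> #|bad_phase e L k| * n ^ 4 <= 2 * n`!.
Proof.
move=> L0 kn nL; rewrite mul2n -addnn.
apply: leq_trans (leq_add (card_not_sparse e kn nL) (card_phase_long_chain e L0 kn nL)).
by rewrite -mulnDl leq_mul2r leq_card_setU orbT.
Qed.

(** * Combining the phases *)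

Lemma good_phase (n : nat) (e : rel 'I_n) (pi : 'S_n) L k r :
  0 < L -> pi \notin bad_phase e L k ->
  (forall v, v \in (greedy_state e pi r).2 -> 2 ^ k <= pi v) ->
  forall v, v \in (greedy_state e pi (r + 80 * L)).2 -> 2 ^ k.+1 <= pi v.
Proof.
move=> L0; rewrite in_setU negb_or in_setC negbK => /andP[sp nlc] Hr v vG.
rewrite leqNgt; apply: contra nlc => vk.
have El : (80 * L).-1.+1 = 80 * L by rewrite prednK //; lia.
(* One round fewer: [80 * L - 1] edges already make [80 * L] vertices. *)
have vG' : v \in (greedy_state e pi (r + (80 * L).-1)).2.
  by apply: subsetP vG; apply: greedy_state_mono; rewrite leq_add2l leq_pred.
have [x [s [ss sv ps As]]] := greedy_survivor_path Hr vG'.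
rewrite -El -ss; apply: path_long_chain ps _ => //.
apply: sub_all As => u /andP[-> uv] /=.
by rewrite leq_min ltn_ord andbT (leq_ltn_trans uv).
Qed.

Lemma greedy_rounds_le (n : nat) (e : rel 'I_n) (pi : 'S_n) L :
  0 < L -> n <= 2 ^ L -> (forall k, 2 ^ k < n -> pi \notin bad_phase e L k) ->
  greedy_rounds e pi <= 1 + 80 * L * L.
Proof.
move=> L0 nL good.
(* The extra round disposes of position 0, which precedes phase 0. *)
have phase k : forall v, v \in (greedy_state e pi (1 + 80 * L * k)).2 -> 2 ^ k <= pi v.
  elim: k => [|k IH].
    move=> v; rewrite muln0 addn0 expn0 lt0n; apply: contraL => /eqP v0.
    rewrite /greedy_state /= !inE negb_and negbK; apply/orP; left.
    by apply/orP; left; apply/forall_inP => u _; rewrite /earlier v0 andbF.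
  have [kn|nk] := leqP n (2 ^ k).
    move=> v; rewrite mulnS => vG; suff /IH : v \in (greedy_state e pi (1 + 80 * L * k)).2.
      by move=> kv; have := leq_ltn_trans (leq_trans kn kv) (ltn_ord (pi v)); rewrite ltnn.
    by apply: subsetP vG; apply: greedy_state_mono; lia.
  by rewrite mulnS [80 * L + _]addnC addnA; apply: good_phase (good k nk) IH.
rewrite /greedy_rounds; case: ex_minnP => m _; apply.
apply/eqP/setP => v; rewrite in_set0; apply/negP => /phase vL.
by have := leq_ltn_trans (leq_trans nL vL) (ltn_ord (pi v)); rewrite ltnn.
Qed.

(** At most [L] phases each fail with probability at most [2 / n^4]; since [2 * L <= n * n], the sum
    is at most [1 / n]. *)
Lemma card_many_rounds (n : nat) (e : rel 'I_n) L : 1 < n -> n <= 2 ^ L -> L <= n ->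
  #|[set pi | 1 + 80 * L * L < greedy_rounds e pi]| * n <= n`!.
Proof.
move=> n1 nL Ln; have L0 : 0 < L by case: (L) nL n1 => // ; rewrite expn0; lia.
set B := [set pi | _].
have le : #|B| <= \sum_(k < L | 2 ^ k < n) #|bad_phase e L k|.
  apply: (@leq_trans #|\bigcup_(k < L | 2 ^ k < n) bad_phase e L k|).
    apply: subset_leq_card; apply/subsetP => pi; rewrite inE ltnNge; apply: contraR.
    move=> npi; apply: greedy_rounds_le => // k kn; apply: contra npi => pk.
    have kL : k < L by rewrite -(ltn_exp2l _ _ (isT : 1 < 2)) (leq_trans kn).
    by apply/bigcupP; exists (Ordinal kL).
  exact: leq_card_bigcup.
have n3 : 0 < n ^ 3 by rewrite expn_gt0; lia.
rewrite -(leq_pmul2r n3) -mulnA -expnS.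
apply: (@leq_trans (\sum_(k < L | 2 ^ k < n) (2 * n`!))).
  apply: (@leq_trans ((\sum_(k < L | 2 ^ k < n) #|bad_phase e L k|) * n ^ 4)).
    by rewrite leq_mul2r le orbT.
  by rewrite big_distrl; apply: leq_sum => k kn; apply: card_bad_phase.
apply: (@leq_trans (\sum_(k < L) (2 * n`!))).
  by rewrite [leqRHS](bigID (fun k : 'I_L => 2 ^ k < n)) /= leq_addr.
rewrite sum_nat_const card_ord mulnA mulnC leq_mul2l; apply/orP; right.
apply: (@leq_trans (n * n)); first by apply: leq_mul.
by rewrite -[n * n]/(n ^ 2) leq_pexp2l // ltnW.
Qed.

(** * The bound over the reals *)

Local Open Scope ring_scope.
Import Order.TTheory GRing.Theory Num.Theory.

(** As [2^(L - 1) < n] and [2 <= n] for the rounded-up logarithm [L], one has [2^L <= n^2]. *)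
Lemma up_log2_ln (R : realType) (n : nat) : (1 < n)%N ->
  (up_log 2 n)%:R * ln 2 <= 2 * ln n%:R :> R.
Proof.
move=> n1; have n0 : (0 < n)%N by apply: ltnW.
have le : (2 ^ up_log 2 n <= n ^ 2)%N.
  have L0 : (0 < up_log 2 n)%N by rewrite up_log_gt0.
  rewrite -(prednK L0) expnS [(n ^ 2)%N]expnS expn1 leq_mul //.
  by apply: ltnW; apply: up_log_gtn.
rewrite mulr_natl [2 * _]mulr_natl -!lnXn ?ltr0n // -!natrX.
by rewrite ler_ln ?posrE ?ltr0n ?expn_gt0 ?n0 // ler_nat.
Qed.

Theorem mainTheorem7 (R : realType) :
  exists C c : R, [/\ 0 < C, 0 < c &
    forall (n : nat) (e : rel 'I_n), (1 < n)%N ->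
      1 - n%:R `^ (- c) <=
      uniform_prob R [set pi : 'S_n |
        (greedy_rounds e pi)%:R <= C * ln n%:R ^+ 2]%SET].
Proof.
have ln2 : 0 < ln 2 :> R by apply: ln_gt0; rewrite ltr1n.
(* [1 + 80 * L^2 <= 81 * L^2] and [L <= 2 * ln n / ln 2] give [324 = 81 * 2^2]; the failure bound
   [1 / n] gives the exponent 1. *)
exists (324 / ln 2 ^+ 2), 1; split=> // [|n e n1].
  by rewrite divr_gt0 ?exprn_gt0 ?ltr0n.
set A := [set pi | _]%SET; set L := up_log 2 n.
have n0 : 0 < n%:R :> R by rewrite ltr0n ltnW.
have L0 : (0 < L)%N by rewrite up_log_gt0.
have nL : (n <= 2 ^ L)%N by apply: up_logP.
have Ln : (L <= n)%N by apply: up_log_min => //; apply: ltnW; apply: ltn_expl.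
have sub : ~: A \subset [set pi | 1 + 80 * L * L < greedy_rounds e pi]%N.
  apply/subsetP => pi; rewrite !inE; apply: contraR; rewrite -leqNgt => le.
  apply: (@le_trans _ _ (81 * L%:R ^+ 2)).
    rewrite -natrX -natrM ler_nat (leq_trans le) //.
    by have : (0 < L * L)%N; rewrite ?muln_gt0 ?L0 // expnS expn1; lia.
  have := up_log2_ln R n1; rewrite -/L => H.
  rewrite -(ler_pM2r (exprn_gt0 2 ln2)) [leRHS]mulrAC divfK ?gt_eqF ?exprn_gt0 //.
  rewrite -[leLHS]mulrA -exprMn (_ : 324 = 81 * 2 ^+ 2); last by rewrite -natrX -natrM.
  rewrite -[leRHS]mulrA -exprMn ler_pM2l ?ltr0n // ler_sqr ?nnegrE //.
    by rewrite mulr_ge0 ?ler0n // ltW.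
  by rewrite mulr_ge0 ?ler0n // ln_ge0 // ler1n ltnW.
have cA : (#|~: A| * n <= n`!)%N.
  apply: leq_trans (card_many_rounds e n1 nL Ln).
  by rewrite leq_mul2r subset_leq_card ?orbT.
have f0 : 0 < n`!%:R :> R by rewrite ltr0n fact_gt0.
rewrite powRN powRr1 ?ler0n // /uniform_prob card_Sn ler_pdivlMr // mulrBl mul1r.
rewrite lerBlDr -[X in X%:R <= _](card_Sn n) -(cardsC A) natrD lerD2l.
by rewrite mulrC ler_pdivlMr // -natrM ler_nat.
Qed.
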